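(* Let $A_T=A_R=A/2$. Then: 1) If $\mathcal{P}_\alpha$ and $\mathcal{P}_\beta$ are the uniform distribution $\mathcal{U}[-1/2,1/2]$ and $\phi_1,\dots,\phi_{G_\theta}$ is a uniform grid in the $\sin\theta$ domain with spacing $2\lambda/A$ (i.e. $\sin\phi_{i+1}-\sin\phi_i=2\lambda/A$), then $$\Psi_\alpha(u^\theta_{1,i})=\Psi_\alpha(2u^\theta_{1,i})=\Psi_\beta(u^\theta_{1,i})=\Psi_\beta(2u^\theta_{1,i})=0\quad\text{for } i=2,3,\dots,G_\theta.$$ 2) If $\mathcal{P}_p$ is the discrete uniform distribution on $\{0,1,\dots,P_{max}-1\}$ and $\rho_1,\dots,\rho_{G_D}$ is a uniform grid with spacing $\lambda/(2P_{max}T_c)$, then $$\Psi_p(u^D_{1,i})=\Psi_p(2u^D_{1,i})=0\quad\text{for } i=2,3,\dots,G_D.$$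
   Context: $\lambda>0$ is the wavelength, $T_c>0$ the chirp duration, $A_T,A_R>0$ are the transmit and receive array apertures with $A=A_T+A_R$, $P_{max}$ is a positive integer (maximal number of chirps), and $G_D,G_\theta$ are the numbers of velocity and angle grid points. $u^D_{i_1,i_2}=\frac{4\pi T_c}{\lambda}(\rho_{i_2}-\rho_{i_1})$ and $u^\theta_{i_1,i_2}=\frac{\pi A}{\lambda}(\sin\phi_{i_2}-\sin\phi_{i_1})$. $\Psi_\alpha,\Psi_\beta,\Psi_p$ denote the characteristic functions of $\mathcal{P}_\alpha,\mathcal{P}_\beta,\mathcal{P}_p$, i.e. $\Psi(u)=\mathbb{E}[e^{juX}]$ for $X$ with the given distribution ($j$ the imaginary unit).
   Formalization: In part 2, Ψ_p(u^D_{1,i})=0 is claimed only when P_max does not divide i−1, and Ψ_p(2u^D_{1,i})=0 only when P_max does not divide 2(i−1); at the excluded indices the value is 1 (e.g. P_max=G_D=i=2 for the second). *)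

(* Defs.v *)
From mathcomp Require Import all_boot all_order all_algebra.
From mathcomp Require Import all_classical all_reals all_analysis.
From mathcomp Require Export complex.

Set Implicit Arguments.
Unset Strict Implicit.
Unset Printing Implicit Defensive.

Import Order.TTheory GRing.Theory Num.Theory.
Import numFieldNormedType.Exports.

Local Open Scope classical_set_scope.
Local Open Scope ring_scope.
Local Open Scope complex_scope.

Definition cexp (R : realType) (z : R[i]) : R[i] :=
  (expR (complex.Re z))%:C
  * (cos (complex.Im z) +i* sin (complex.Im z)).

(* [fine] is harmless for integrable (e.g. bounded measurable) Z. *)
Definition Cexpectation d (T : measurableType d) (R : realType)
    (P : probability T R) (Z : T -> R[i]) : R[i] :=
  fine ('E_P[fun w => complex.Re (Z w)])%E
  +i* fine ('E_P[fun w => complex.Im (Z w)])%E.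

(* The random variable with law mu is the identity on (R, mu). *)
Definition charfun (R : realType) (mu : probability (measurableTypeR R) R)
    (u : R) : R[i] :=
  Cexpectation mu (fun x : measurableTypeR R => cexp ('i%C * (u * x)%:C)).

Fact unit_interval_lt (R : realType) : - 2^-1 < 2^-1 :> R.
Proof. by apply: (@lt_trans _ _ 0); rewrite ?oppr_lt0 invr_gt0 ltr0n. Qed.

Definition is_uniform_unit (R : realType)
    (mu : probability (measurableTypeR R) R) : Prop :=
  forall S : set (measurableTypeR R), measurable S ->
    mu S = uniform_prob (unit_interval_lt R) S.

Definition is_discrete_uniform (R : realType) (n : nat)
    (mu : probability (measurableTypeR R) R) : Prop :=
  forall S : set (measurableTypeR R), measurable S ->
    mu S = ((n%:R^-1 : R)%:E
            * \sum_(k < n) \d_(k%:R : measurableTypeR R) S)%E.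

(* Grids x_1, ..., x_G are 1-based: only x 1, ..., x G are meaningful. *)
Definition uniform_grid (R : realType) (G : nat) (x : nat -> R) (h : R) : Prop :=
  forall i : nat, (1 <= i < G)%N -> x i.+1 - x i = h.

Definition uD (R : realType) (lambda Tc : R) (rho : nat -> R)
    (i1 i2 : nat) : R :=
  4 * pi * Tc / lambda * (rho i2 - rho i1).

Definition utheta (R : realType) (lambda A : R) (phi : nat -> R)
    (i1 i2 : nat) : R :=
  pi * A / lambda * (sin (phi i2) - sin (phi i1)).

(* Main.v *)
Require Import Defs.
From mathcomp Require Import all_boot all_order all_algebra.
From mathcomp Require Import all_classical all_reals all_analysis.
From mathcomp Require Import measurable_realfun ring.

Set Implicit Arguments.
Unset Strict Implicit.
Unset Printing Implicit Defensive.

Import Order.TTheory GRing.Theory Num.Theory.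
Import numFieldNormedType.Exports.

Local Open Scope ring_scope.

(** On the grids, the arguments of the characteristic functions are
    [u = 2 * pi * m] with [m > 0] in part 1, so that the uniform law on an
    interval of length one integrates [x |-> cos (u * x - t)] over [m] full
    periods, and [u = 2 * pi * m / P_max] in part 2, so that the expectation of
    [cos (u * x - t)] is a sum which telescopes after multiplication by
    [2 * sin (u / 2)], a nonzero number when [P_max] does not divide [m].
    The phases [t = 0] and [t = pi / 2] give the real and the imaginary part
    of the characteristic function. *)

Lemma continuous_cos_affine (R : realType) (u t : R) :
  continuous (fun x => cos (u * x - t)).
Proof.
move=> x; apply: (@continuous_comp _ _ _ (fun x : R => u * x - t) cos).
  apply: cvgB; last exact: cvg_cst.
  by apply: cvgM; [exact: cvg_cst|exact: cvg_id].
exact: continuous_cos.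
Qed.

Lemma measurable_cos_affine (R : realType) (u t : R) :
  measurable_fun setT (fun x : measurableTypeR R => cos (u * x - t)).
Proof.
apply: continuous_measurable_fun.
exact: continuous_cos_affine.
Qed.

(* The summand 1 makes the integrand nonnegative, as the formulas for integrals
   against uniform and sum measures require. *)
Lemma charfun_eq0 (R : realType) (mu : probability (measurableTypeR R) R)
    (u : R) :
  (forall t, \int[mu]_x (1 + cos (u * x - t))%:E = 1)%E -> charfun mu u = 0.
Proof.
move=> int1.
have Ecos t : ('E_mu[fun x => cos (u * x - t)] = 0)%E.
  (* Bounded measurable functions are integrable because [mu] has finite total mass; this lets the
     integral be split below. *)
  have bounded_int (f : measurableTypeR R -> R) : measurable_fun setT f ->
      (forall x, `|f x| <= 1) -> mu.-integrable setT (EFin \o f).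
    move=> mf f1; apply: measurable_bounded_integrable => //.
      by rewrite (le_lt_trans (probability_le1 _ _))// ltry.
    by exists 1; split=> // M M1 x _ /=; rewrite (le_trans (f1 x))// ltW.
  have intcos : mu.-integrable setT (fun x => (cos (u * x - t))%:E).
    apply: bounded_int; first exact: measurable_cos_affine.
    by move=> x; exact: cos_max.
  have int_cst1 : mu.-integrable setT (EFin \o cst 1).
    by apply: bounded_int => // x; rewrite normr1.
  have := int1 t.
  under eq_integral do rewrite EFinD.
  rewrite (integralD measurableT int_cst1 intcos).
  have -> : (\int[mu]_x 1%:E = 1)%E.
    by have := expectation_cst mu 1; rewrite expectation.unlock.
  (* Integrability makes the integral of the cosine a real [r], so [1 + r = 1] can be solved for
     [r]. *)
  rewrite expectation.unlock; have /= := integrable_fin_num measurableT intcos.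
  case: (\int[mu]_x _)%E => // r _.
  by move=> [] /(canRL (addKr 1)) ->; rewrite addNr.
have ReZ (x : R) : complex.Re (cexp ('i%C * ((u * x)%:C)%C)) = cos (u * x - 0).
  rewrite /cexp /= !(mul0r, mul1r, mulr0, addr0, subr0, add0r, oppr0) expR0.
  by rewrite mul1r.
have ImZ (x : R) :
    complex.Im (cexp ('i%C * ((u * x)%:C)%C)) = cos (u * x - pi / 2).
  rewrite /cexp /= !(mul0r, mul1r, mulr0, addr0, subr0, add0r, oppr0) expR0.
  by rewrite mul1r cosBpihalf.
rewrite /charfun /Cexpectation (funext ReZ) (funext ImZ).
by rewrite !Ecos.
Qed.

Lemma is_derive_primitive_cos (R : realType) (u t x : R) : u != 0 ->
  is_derive x 1 (fun y => y + u^-1 * sin (u * y - t)) (1 + cos (u * x - t)).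
Proof.
move=> u0.
have dy : is_derive x 1 (fun y : R => u * y - t) u.
  have := is_deriveB (is_deriveZ u (is_derive_id x 1)) (is_derive_cst t x 1).
  by rewrite subr0 /GRing.scale/= mulr1.
have dsin := @is_derive1_comp _ sin _ x _ _ (is_derive_sin (u * x - t)) dy.
have := is_deriveD (is_derive_id x 1) (is_deriveZ u^-1 dsin).
move/is_derive_eq; apply.
by rewrite /GRing.scale/= mulrCA mulVf// mulr1.
Qed.

Lemma integral_uniform_unit_cos (R : realType)
    (mu : probability (measurableTypeR R) R) (m : nat) (t : R) :
  (0 < m)%N -> is_uniform_unit mu ->
  (\int[mu]_x (1 + cos (2 * pi * m%:R * x - t))%:E = 1)%E.
Proof.
move=> m0 mu_unif; set u := 2 * pi * m%:R.
have u0 : u != 0 by rewrite !mulf_neq0// ?gt_eqF ?pi_gt0// ltr0n.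
rewrite (eq_measure_integral (uniform_prob (unit_interval_lt R))); last first.
  by move=> S mS _; exact: mu_unif.
rewrite integral_uniform; last 2 first.
- by apply/measurable_EFinP/measurable_funD => //; exact: measurable_cos_affine.
- by move=> x; rewrite lee_fin -lerBlDl sub0r cos_geN1.
pose F x := x + u^-1 * sin (u * x - t).
have dF (x : R) : is_derive x 1 F (1 + cos (u * x - t)).
  exact: is_derive_primitive_cos.
have cF (x : R) : {for x, continuous F}.
  by apply/differentiable_continuous/derivable1_diffP; case: (dF x).
rewrite (@continuous_FTC2 _ _ F).
- have -> : (2^-1 - - 2^-1 : R) = 1 by field.
  rewrite invr1 mul1e -EFinB /F.
  (* The endpoints are at distance one, so the phases differ by [u], that is [m] full periods: the
     sine terms of [F] cancel and the length 1 remains. *)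
  have -> : u * 2^-1 - t = u * - 2^-1 - t + pi *+ 2 *+ m.
    by rewrite -[pi *+ 2]mulr_natl -[_ *+ m]mulr_natr /u; field.
  by rewrite (periodicn (@sinD2pi R)); congr (_%:E); field.
- exact: unit_interval_lt.
- apply/continuous_subspaceT => x.
  by apply: cvgD; [exact: cvg_cst|exact: continuous_cos_affine].
- split.
  + by move=> x _; case: (dF x).
  + by apply: cvg_at_right_filter; exact: cF.
  + by apply: cvg_at_left_filter; exact: cF.
- by move=> x _; rewrite derive1E; exact: derive_val.
Qed.

(** With [a = u * k - t], the product [2 * sin (u / 2) * cos a] equals
    [sin (a + u / 2) - sin (a - u / 2)], and the first term for [k] is the second one for
    [k + 1]. *)
Lemma sum_cos_arith (R : realType) (u t : R) (n : nat) :
  2 * sin (u / 2) * \sum_(k < n) cos (u * k%:R - t)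
  = sin (u * n%:R - u / 2 - t) - sin (- (u / 2) - t).
Proof.
elim: n => [|n IHn]; first by rewrite big_ord0 mulr0 mulr0 sub0r subrr.
rewrite big_ord_recr/= mulrDr IHn.
have -> : u * n.+1%:R - u / 2 - t = (u * n%:R - t) + u / 2.
  by rewrite -natr1; field.
have -> : u * n%:R - u / 2 - t = (u * n%:R - t) - u / 2 by ring.
by rewrite (sinB (_ * _ - t)) (sinD (_ * _ - t)); ring.
Qed.

(** Reducing [m] modulo [n] shifts the angle by a multiple of [pi], which only affects the sign; the
    nonzero remainder puts the angle strictly between 0 and [pi]. *)
Lemma sin_pi_frac_neq0 (R : realType) (n m : nat) : (0 < n)%N ->
  ~~ (n %| m)%N -> sin (pi * m%:R / n%:R) != 0 :> R.
Proof.
move=> n0 ndvd.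
have nR0 : n%:R != 0 :> R by rewrite pnatr_eq0 -lt0n.
have -> : pi * m%:R / n%:R = pi * (m %% n)%:R / n%:R + pi *+ (m %/ n) :> R.
  by rewrite {1}(divn_eq m n) natrD natrM -mulr_natr; field.
rewrite alternatingn; last exact: sinDpi.
rewrite mulf_neq0 ?signr_eq0// gt_eqF// sin_gt0_pi//.
have r0 : (0 < m %% n)%N by rewrite lt0n.
rewrite divr_gt0 ?mulr_gt0 ?pi_gt0 ?ltr0n//=.
by rewrite ltr_pdivrMr ?ltr0n// ltr_pM2l ?pi_gt0// ltr_nat ltn_mod.
Qed.

Lemma integral_discrete_uniform_cos (R : realType) (n : nat)
    (mu : probability (measurableTypeR R) R) (m : nat) (t : R) :
  (0 < n)%N -> ~~ (n %| m)%N -> is_discrete_uniform n mu ->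
  (\int[mu]_x (1 + cos (2 * pi * m%:R / n%:R * x - t))%:E = 1)%E.
Proof.
move=> n0 ndvd mu_unif; set u := 2 * pi * m%:R / n%:R.
have nR0 : n%:R != 0 :> R by rewrite pnatr_eq0 -lt0n.
pose f (x : measurableTypeR R) : \bar R := (1 + cos (u * x - t))%:E.
have mf : measurable_fun setT f.
  by apply/measurable_EFinP/measurable_funD => //; exact: measurable_cos_affine.
have f0 x : (0 <= f x)%E by rewrite lee_fin -lerBlDl sub0r cos_geN1.
have ninv_ge0 : 0 <= n%:R^-1 :> R by rewrite invr_ge0 ler0n.
pose dirac_nat k : {measure set (measurableTypeR R) -> \bar R} :=
  \d_(k%:R : measurableTypeR R).
(* As a scaled finite sum of Dirac measures, the law turns the integral into the average of [f] over
   [0, ..., n - 1]. *)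
rewrite (eq_measure_integral (mscale (NngNum ninv_ge0) (msum dirac_nat n)));
  last by move=> S mS _; exact: mu_unif.
rewrite -/f ge0_integral_mscale// ge0_integral_measure_sum//.
under eq_bigr do rewrite integral_dirac// diracT mul1e.
rewrite sumEFin/= -EFinM; congr (_%:E).
suff -> : \sum_(k < n) (1 + cos (u * k%:R - t)) = n%:R by rewrite mulVf.
rewrite big_split/= sumr_const card_ord.
suff -> : \sum_(k < n) cos (u * k%:R - t) = 0 by rewrite addr0.
have s0 : 2 * sin (u / 2) != 0.
  rewrite mulf_neq0//.
  have -> : u / 2 = pi * m%:R / n%:R by rewrite /u; field.
  exact: sin_pi_frac_neq0.
apply: (mulfI s0); rewrite sum_cos_arith mulr0.
(* The two ends of the telescoped sum differ by [u * n], again [m] full periods. *)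
have -> : u * n%:R - u / 2 - t = - (u / 2) - t + pi *+ 2 *+ m.
  by rewrite -[pi *+ 2]mulr_natl -[_ *+ m]mulr_natr /u; field.
by rewrite (periodicn (@sinD2pi R)) subrr.
Qed.

Lemma uniform_gridB1 (R : realType) (G : nat) (x : nat -> R) (h : R) (i : nat) :
  uniform_grid G x h -> (1 <= i <= G)%N -> x i - x 1%N = (i - 1)%:R * h.
Proof.
(* Indices start at 1: the case 0 contradicts the bound, and 1 is the actual base case. *)
move=> grid; elim: i => // -[_ _|i IHi iG]; first by rewrite subrr mul0r.
have /grid step : (1 <= i.+1 < G)%N by [].
have := IHi (ltnW iG); rewrite !subn1/= -natr1 mulrDl mul1r => <-.
by rewrite -step; ring.
Qed.

(** The divisibility conditions in part 2 exclude the arguments that are multiples of [2 * pi],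
    where the characteristic function of an integer-valued law equals 1. *)
Theorem proposition5 (R : realType)
    (lambda Tc A_T A_R A : R) (P_max G_D G_theta : nat)
    (rho phi : nat -> R)
    (P_alpha P_beta P_p : probability (measurableTypeR R) R)
    (lambda_gt0 : 0 < lambda) (Tc_gt0 : 0 < Tc)
    (A_T_gt0 : 0 < A_T) (A_R_gt0 : 0 < A_R) (defA : A = A_T + A_R)
    (P_max_gt0 : (0 < P_max)%N)
    (A_T_half : A_T = A / 2) (A_R_half : A_R = A / 2) :
  (is_uniform_unit P_alpha -> is_uniform_unit P_beta ->
   uniform_grid G_theta (fun i => sin (phi i)) (2 * lambda / A) ->
   forall i : nat, (2 <= i <= G_theta)%N ->
     [/\ charfun P_alpha (utheta lambda A phi 1 i) = 0,
         charfun P_alpha (2 * utheta lambda A phi 1 i) = 0,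
         charfun P_beta (utheta lambda A phi 1 i) = 0
       & charfun P_beta (2 * utheta lambda A phi 1 i) = 0])
  /\
  (is_discrete_uniform P_max P_p ->
   uniform_grid G_D rho (lambda / (2 * P_max%:R * Tc)) ->
   forall i : nat, (2 <= i <= G_D)%N ->
     (~~ (P_max %| i - 1)%N -> charfun P_p (uD lambda Tc rho 1 i) = 0)
     /\
     (~~ (P_max %| 2 * (i - 1))%N ->
        charfun P_p (2 * uD lambda Tc rho 1 i) = 0)).
Proof.
have l0 : lambda != 0 by rewrite gt_eqF.
split=> [alpha_unif beta_unif grid i /andP[i2 iG]|p_unif grid i /andP[i2 iG]].
- have A0 : A != 0 by rewrite defA gt_eqF// addr_gt0.
  have utE : utheta lambda A phi 1 i = 2 * pi * (i - 1)%:R.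
    by rewrite /utheta (uniform_gridB1 grid) ?(ltnW i2)//; field; rewrite l0 A0.
  (* Doubling the argument only replaces [m = i - 1] by [2 * (i - 1)], so one integral lemma serves
     both claims; the same holds in part 2. *)
  have ut2E : 2 * utheta lambda A phi 1 i = 2 * pi * (2 * (i - 1))%:R.
    by rewrite utE natrM; ring.
  have i1 : (0 < i - 1)%N by rewrite subn_gt0.
  by rewrite ut2E utE; split; apply: charfun_eq0 => t;
    apply: integral_uniform_unit_cos; rewrite ?muln_gt0.
- have Tc0 : Tc != 0 by rewrite gt_eqF.
  have P0 : P_max%:R != 0 :> R by rewrite pnatr_eq0 -lt0n.
  have uE : uD lambda Tc rho 1 i = 2 * pi * (i - 1)%:R / P_max%:R.
    rewrite /uD (uniform_gridB1 grid) ?(ltnW i2)//; field.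
    by rewrite l0 Tc0 P0.
  have u2E : 2 * uD lambda Tc rho 1 i = 2 * pi * (2 * (i - 1))%:R / P_max%:R.
    by rewrite uE natrM; field.
  by rewrite u2E uE; split=> ndvd; apply: charfun_eq0 => t;
    exact: integral_discrete_uniform_cos.
Qed.
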